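(* Let $G$ be a connected planar graph of order $n$ with minimum degree $\delta(G)\geq 3$. Then $$ {}^{\partial}\gamma_{M}(G) \geq \frac{n}{2}+1.$$
   Context: All graphs are finite and simple (partial duals, however, may have loops or multiple edges). The order of a graph is its number of vertices. All embeddings are cellular. A planar graph $G$ is regarded as an embedded graph via an embedding on the sphere. Partial dual: Let $G$ be a graph cellularly embedded on an orientable surface, viewed as a ribbon graph (a thickened neighbourhood of $G$ consisting of vertex discs and edge ribbons), and let $A\subseteq E(G)$. The partial dual $G^A$ of $G$ with respect to $A$ (Chmutov) is the embedded graph (ribbon graph) obtained as follows: glue a disc to $G$ along each boundary component of the spanning ribbon subgraph $(V(G),A)$ (these discs are the vertex discs of $G^A$), and remove the interiors of all vertex discs of $G$; the edge ribbons are kept. In particular $G^{\emptyset}=G$ and $G^{E(G)}=G^*$, the geometric dual. Write $\gamma(G^A)$ for the genus of the (orientable) surface on which $G^A$ is cellularly embedded. Equivalently, for $G$ connected, $2-2\gamma(G^A)=f(A)-|E(G)|+f(E(G)\setminus A)$, where $f(B)$ is the number of boundary components of the spanning ribbon subgraph $(V(G),B)$. The maximum partial-dual genus of $G$ is ${}^{\partial}\gamma_M(G):=\max_{A\subseteq E(G)}\gamma(G^A)$. For a connected planar graph $G$ it is known that this value does not depend on the chosen embedding of $G$ on the sphere. *)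

(* Defs.v *)
From HB Require Import structures.
From mathcomp Require Import all_boot all_order all_algebra all_fingroup.

Set Implicit Arguments.
Unset Strict Implicit.
Unset Printing Implicit Defensive.

Import Order.TTheory GRing.Theory Num.Theory.
Local Open Scope ring_scope.

(** * Finite simple graphs *)

Record sgraph := SGraph {
  vertex :> finType;
  adj : rel vertex;
  adj_sym : symmetric adj;
  adj_irr : irreflexive adj }.

(* The empty graph is not connected. *)
Definition connected (G : sgraph) : Prop :=
  (0 < #|G|)%N /\ forall x y : G, connect (@adj G) x y.

Definition degree (G : sgraph) (x : G) : nat := #|[set y : G | adj x y]|.

(* Degrees are smaller than #|G|, so the default value #|G| of the minimum
   only matters for the empty graph. *)
Definition min_degree (G : sgraph) : nat :=
  \big[minn/#|G|]_(x : G) degree x.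

(** * Orientable ribbon graphs *)

(* An orientable ribbon graph (loops and multiple edges allowed) as a
   combinatorial map: a dart is an end of an edge ribbon, [rot] sends a dart to
   the next one around its vertex disc, and [inv] exchanges the two ends of
   each ribbon.  Isolated vertices carry no dart and are not recorded; such a
   vertex is a sphere component, unchanged by partial duality and without
   effect on the genus. *)
Record ribbon_graph := RibbonGraph {
  dart : finType;
  rot : {perm dart};
  inv : {perm dart};
  inv_invol : involutive inv;
  inv_free : forall d, inv d != d }.

Definition vertices (M : ribbon_graph) : {set {set dart M}} := porbits (rot M).

Definition edges (M : ribbon_graph) : {set {set dart M}} := porbits (inv M).

(* Following a boundary component of the ribbon surface, one runs along the
   ribbon of d to its other end, then to the next dart of the vertex there:
   d |-> rot (inv d), where permutations compose from left to right. *)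
Definition faces (M : ribbon_graph) : {set {set dart M}} :=
  porbits (inv M * rot M)%g.

Definition components (M : ribbon_graph) : {set {set dart M}} :=
  [set orbit 'P <<[set rot M; inv M]>>%g d | d : dart M].

(* Euler's formula 2 k - 2 g = v - e + f, where g is the sum of the genera of
   the k components; it is solved in [rat] to avoid truncation. *)
Definition genus (M : ribbon_graph) : rat :=
  #|components M|%:R
    - (#|vertices M|%:R - #|edges M|%:R + #|faces M|%:R) / 2%:R.

(** * Partial duals *)

Section PartialDual.
Variables (M : ribbon_graph) (A : {set {set dart M}}).

Definition restr_inv_fun (d : dart M) : dart M :=
  if porbit (inv M) d \in A then inv M d else d.

Lemma restr_inv_invol : involutive restr_inv_fun.
Proof.
move=> d; rewrite /restr_inv_fun; case: (boolP (porbit (inv M) d \in A)) => dA.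
  have -> : porbit (inv M) (inv M d) = porbit (inv M) d.
    by apply/eqP; rewrite eq_porbit_mem -{1}(expg1 (inv M)) mem_porbit.
  by rewrite dA inv_invol.
by rewrite (negPf dA).
Qed.

(* [inv M] on the ends of the ribbons in A, the identity elsewhere. *)
Definition restr_inv : {perm dart M} := perm (inv_inj restr_inv_invol).

(* The vertex discs of the partial dual are glued along the boundary components
   of the spanning ribbon subgraph (V, A).  The walk along these components
   crosses the ribbons in A and passes by the ends of the other ribbons, so it
   is d |-> rot (restr_inv d).  The ribbons are kept: one not in A meets the
   new discs in its two ends, one in A in its two sides, the side leaving from
   the end d being labelled by d; in both cases [inv M] exchanges the two
   attaching arcs. *)
Definition partial_dual : ribbon_graph :=
  @RibbonGraph (dart M) (restr_inv * rot M)%g (inv M)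
    (@inv_invol M) (@inv_free M).

End PartialDual.

(* Starting the maximum at the subset A = set0 only makes it non-empty. *)
Definition max_partial_dual_genus (M : ribbon_graph) : rat :=
  \big[Order.max/genus (partial_dual (@set0 {set dart M}))]_(
      A : {set {set dart M}} | A \subset edges M) genus (partial_dual A).

(** * Embedded simple graphs *)

Section Embedding.
Variable G : sgraph.

Definition gdart := {p : G * G | adj p.1 p.2}.

Definition origin (d : gdart) : G := (val d).1.

Lemma gdart_rev_proof (d : gdart) : adj (val d).2 (val d).1.
Proof. by rewrite adj_sym; exact: (valP d). Qed.

Definition gdart_rev_fun (d : gdart) : gdart :=
  exist (fun p : G * G => adj p.1 p.2) ((val d).2, (val d).1)
    (gdart_rev_proof d).

Lemma gdart_rev_invol : involutive gdart_rev_fun.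
Proof. by move=> d; apply: val_inj => /=; case: (val d). Qed.

Definition gdart_rev : {perm gdart} := perm (inv_inj gdart_rev_invol).

Lemma gdart_revK : involutive gdart_rev.
Proof. by move=> d; rewrite !permE gdart_rev_invol. Qed.

Lemma gdart_rev_free d : gdart_rev d != d.
Proof.
rewrite permE; apply/eqP => /(congr1 val) /= rev_d.
have := valP d; rewrite /=; case: (val d) rev_d => x y [-> _] /=.
by rewrite adj_irr.
Qed.

(* A cellular embedding in an oriented closed surface, up to homeomorphism,
   given by its rotation system: a cyclic order on the darts at each vertex. *)
Record embedding := Embedding {
  rotation : {perm gdart};
  rotationP : forall d, porbit rotation d = [set d' | origin d' == origin d] }.

Definition ribbon (r : embedding) : ribbon_graph :=
  @RibbonGraph gdart (rotation r) gdart_rev gdart_revK gdart_rev_free.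

(* For G connected, genus 0 means that the surface is the sphere. *)
Definition spherical (r : embedding) : Prop := genus (ribbon r) = 0.

End Embedding.

(* Main.v *)
Require Import Defs.
From mathcomp Require Import all_boot all_order all_algebra all_fingroup.
From mathcomp Require Import zify lra.
Set Implicit Arguments.
Unset Strict Implicit.
Unset Printing Implicit Defensive.

Import Order.TTheory GRing.Theory Num.Theory.
Local Open Scope ring_scope.

(** Write f(A) for the number of boundary components of (V, A), r(A) for the
rank of A in the cycle matroid of G, and E for the set of edges.  Since f(A)
counts the vertices of G^A and f(E - A) its faces, the claim says that
f(A) + f(E - A) <= |E| - n for some A.

Adding an edge changes f by one, up or down, and when the edge raises the rank
its ends lie in different components, hence on different boundary components,
which it merges.  So f(A) <= n + |A| - 2 r(A) ([card_boundary_le]), and it is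
enough to find A with r(A) + r(E - A) >= 3n/2.

By matroid union such an A exists as soon as |E - F| + 2 r(F) >= 3n/2 for all
F; the required half of that theorem has a short inductive proof for arbitrary
submodular functions ([submodular_split]).  To check the condition, choose a
vertex x in each component C of (V, F).  As G is simple, at most |C| - 1 edges
of F leave x, so at least 4 - |C| of the three or more edges at x avoid F.
Summing over the c components gives 4 c <= n + 2 |E - F|
([card_classes_le]), and r(F) = n - c turns this into the condition.

The rank is taken to be the dimension of the span of the vectors v_x - v_y, for
xy in A, where (v_x) is a basis indexed by the vertices: submodularity is then
the dimension formula, and being in the same component becomes the linear
condition that v_x - v_y lies in the span, which needs no paths. *)

(** * Splitting a set between two submodular functions *)

Definition submodular {T : finType} (r : {set T} -> nat) : Prop :=
  forall A B : {set T}, (r (A :|: B) + r (A :&: B) <= r A + r B)%N.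

(** The min-max half of matroid union.  Decide on which side to put one element
e: putting it in A replaces r1 by X |-> r1 (e |: X), which is still submodular,
and likewise for r2.  If both choices violate the hypothesis, at F2 and F1
respectively, then submodularity applied to these two violations contradicts
the hypothesis at e |: (F1 :|: F2) or at F1 :&: F2. *)
Lemma submodular_split {T : finType} (k : nat) (r1 r2 : {set T} -> nat)
    (E : {set T}) :
  submodular r1 -> submodular r2 ->
  (forall F : {set T}, F \subset E -> (k <= #|E :\: F| + r1 F + r2 F)%N) ->
  exists2 A : {set T}, A \subset E & (k <= r1 A + r2 (E :\: A))%N.
Proof.
move: {2}#|E| (erefl #|E|) => m.
elim: m E r1 r2 => [|m IHm] E r1 r2 cardE sub1 sub2 kE.
  have -> : E = set0 by apply/eqP; rewrite -cards_eq0 cardE.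
  exists set0; first exact: sub0set.
  by have := kE set0 (sub0set _); rewrite !setD0 cardE.
have [e eE] : exists e, e \in E by apply/card_gt0P; rewrite cardE.
have submod_e (r : {set T} -> nat) :
    submodular r -> submodular (fun X => r (e |: X)).
  by move=> subr X Y; rewrite setUUr setUIr; apply: subr.
have cardE' : #|E :\ e| = m by move: cardE; rewrite (cardsD1 e) eE => -[].
have inE' (X : {set T}) : X \subset E :\ e -> X \subset E.
  by move=> /subset_trans; apply; apply: subsetDl.
have [/forall_inP okA|] := boolP [forall (F : {set T} | F \subset E :\ e),
    k <= #|(E :\ e) :\: F| + r1 (e |: F) + r2 F]%N.
  have [A sA kA] := IHm _ _ _ cardE' (submod_e _ sub1) sub2 okA.
  exists (e |: A); first by rewrite subUset sub1set eE inE'.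
  by rewrite -setDDl.
have [/forall_inP okB _|] := boolP [forall (F : {set T} | F \subset E :\ e),
    k <= #|(E :\ e) :\: F| + r1 F + r2 (e |: F)]%N.
  have [A sA kA] := IHm _ _ _ cardE' sub1 (submod_e _ sub2) okB.
  exists A; first exact: inE'.
  suff -> : E :\: A = e |: (E :\ e) :\: A by [].
  apply/setP => x; rewrite !inE; have [->|] //= := eqVneq x e.
  rewrite eE andbT; apply/negP => eA.
  by have := subsetP sA _ eA; rewrite !inE eqxx.
rewrite !negb_forall_in.
move=> /exists_inP[/= F1 sF1 kF1] /exists_inP[/= F2 sF2 kF2].
have kU : (k <= #|E :\: (e |: (F1 :|: F2))| + r1 (e |: (F1 :|: F2)) +
           r2 (e |: (F1 :|: F2)))%N.
  by apply: kE; rewrite !subUset sub1set eE !inE'.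
have kI : (k <= #|E :\: (F1 :&: F2)| + r1 (F1 :&: F2) + r2 (F1 :&: F2))%N.
  by apply: kE; rewrite subIset // inE'.
have eNF (X : {set T}) : X \subset E :\ e -> e \notin X.
  by move=> /subsetP sX; apply/negP => /sX; rewrite !inE eqxx.
have capl (X Y : {set T}) :
      e \notin X -> e \notin Y -> Y :&: (e |: X) = Y :&: X.
  move=> eX eY; apply/setP => x; rewrite !inE.
  by have [->|] := eqVneq x e; rewrite // (negPf eX) (negPf eY).
have := sub1 F1 (e |: F2); rewrite setUCA capl ?eNF //.
have := sub2 (e |: F1) F2; rewrite -setUA [_ :&: F2]setIC capl ?eNF // setIC.
have := cardsUI ((E :\ e) :\: F1) ((E :\ e) :\: F2).
rewrite -setDIr -setDUr [in _ :\: (_ :|: _)]setDDl.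
have : #|E :\: (F1 :&: F2)| = #|(E :\ e) :\: (F1 :&: F2)|.+1 :> nat.
  rewrite (cardsD1 e (E :\: _)) !inE eE (negPf (eNF _ sF1)) /= add1n.
  by rewrite setDDl setUC -setDDl.
move: kU kI kF1 kF2; lia.
Qed.

(** * Boundary components and rank *)

(* These names are also used for group inverses and for rotations of lists. *)
Local Notation inv := Defs.inv.
Local Notation rot := Defs.rot.

Section Ribbon.
Variable M : ribbon_graph.
Implicit Types A B : {set {set dart M}}.

Lemma edgeE (d : dart M) : porbit (inv M) d = [set d; inv M d].
Proof.
apply/setP => x; rewrite !inE; apply/porbitP/pred2P; last first.
  by case=> ->; [exists 0%N; rewrite expg0 perm1 | exists 1%N; rewrite expg1].
case=> i ->; elim: i => [|i IHi]; first by rewrite expg0 perm1; left.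
by rewrite expgSr permM; case: IHi => ->; [right | left; rewrite inv_invol].
Qed.

Lemma edge_inv (d : dart M) : porbit (inv M) (inv M d) = porbit (inv M) d.
Proof. by rewrite !edgeE inv_invol setUC. Qed.

Lemma card_darts_over A : A \subset edges M ->
  #|[set d | porbit (inv M) d \in A]| = (2 * #|A|)%N.
Proof.
move=> /subsetP sAE.
rewrite -sum1_card (partition_big (porbit (inv M)) (mem A)) /=; last first.
  by move=> d; rewrite inE.
transitivity (\sum_(e in A) 2)%N; last by rewrite sum_nat_const mulnC.
apply: eq_bigr => e eA; have /imsetP[d _ de] := sAE _ eA.
transitivity #|e|; last by rewrite de edgeE cards2 eq_sym inv_free.
rewrite -sum1_card; apply: eq_bigl => x.
rewrite inE de porbit_sym -eq_porbit_mem eq_sym andbC.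
by case: eqP => // <-; rewrite -de eA.
Qed.

(** Its cycles are the boundary components of the spanning ribbon subgraph
with edge set A. *)
Definition boundary A : {perm dart M} := (restr_inv A * rot M)%g.

Lemma restr_invE A d :
  restr_inv A d = if porbit (inv M) d \in A then inv M d else d.
Proof. by rewrite permE. Qed.

(** Attaching one ribbon multiplies the boundary walk by the transposition of
its two ends, which joins two cycles or cuts one. *)
Lemma boundary_add A d : porbit (inv M) d \notin A ->
  boundary (porbit (inv M) d |: A) = (tperm d (inv M d) * boundary A)%g.
Proof.
move=> dA; rewrite /boundary mulgA; congr (_ * _)%g; apply/permP => x.
rewrite permM !restr_invE !inE.
case: tpermP => [->|->|/eqP xd /eqP xid].
- by rewrite eqxx edge_inv (negPf dA).
- by rewrite edge_inv eqxx (negPf dA) inv_invol.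
by rewrite eq_porbit_mem edgeE !inE (negPf xd) (negPf xid).
Qed.

(** Crossing every ribbon and then those of A again amounts to crossing the
ribbons outside A. *)
Lemma faces_partial_dual A :
  faces (partial_dual A) = porbits (boundary (edges M :\: A)).
Proof.
rewrite /faces /= mulgA; congr (porbits (_ * _)%g).
apply/permP => d; rewrite permM !restr_invE edge_inv inE imset_f //.
by case: ifP => _ /=; rewrite ?inv_invol ?andbT.
Qed.

Section EdgeSpace.
(* [b] labels each dart with a vector that depends only on its vertex. *)
Variables (K : fieldType) (vT : vectType K) (b : dart M -> vT).
Hypothesis b_rot : forall d, b (rot M d) = b d.

Definition edge_space A : {vspace vT} :=
  (\sum_(d | porbit (inv M) d \in A) <[b d - b (inv M d)]>)%VS.

Lemma mem_edge_space A d :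
  porbit (inv M) d \in A -> b d - b (inv M d) \in edge_space A.
Proof. by move=> dA; rewrite memvE (sumv_sup d). Qed.

Lemma edge_spaceS A B : A \subset B -> (edge_space A <= edge_space B)%VS.
Proof.
move=> /subsetP sAB; apply/subv_sumP => d dA.
by apply: (sumv_sup d); rewrite ?sAB.
Qed.

Lemma edge_spaceU A B :
  edge_space (A :|: B) = (edge_space A + edge_space B)%VS.
Proof.
apply/eqP; rewrite eqEsubv subv_add !edge_spaceS ?subsetUl ?subsetUr // !andbT.
apply/subv_sumP => d; rewrite inE => /orP[] dAB.
  by rewrite -memvE (subvP (addvSl _ _)) ?mem_edge_space.
by rewrite -memvE (subvP (addvSr _ _)) ?mem_edge_space.
Qed.

Lemma edge_rank_submodular : submodular (fun A => \dim (edge_space A)).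
Proof.
move=> A B /=; rewrite edge_spaceU -(dimv_sum_cap (edge_space A)) leq_add2l.
by rewrite dimvS // subv_cap !edge_spaceS ?subsetIl ?subsetIr.
Qed.

(** A boundary walk of (V, A) stays in one component: each step turns around a
vertex, after crossing a ribbon of A or none. *)
Lemma boundary_edge_space A d d' :
  d' \in porbit (boundary A) d -> b d - b d' \in edge_space A.
Proof.
case/porbitP => i ->; elim: i => [|i IHi].
  by rewrite expg0 perm1 subrr mem0v.
rewrite expgSr permM; move: ((boundary A ^+ i)%g d) IHi => x IHi.
rewrite permM b_rot restr_invE; case: ifP => // xA.
by rewrite -(subrKA (b x)) memvD // mem_edge_space.
Qed.

(** This amounts to the nonnegativity of the genera of the components of
(V, A).  Add the edges one at a time: the number of cycles grows by at most
one, and it drops by one whenever the dimension grows, because the ends of the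
new edge are then on different boundary components. *)
Lemma card_boundary_le A : A \subset edges M ->
  (#|porbits (boundary A)| + 2 * \dim (edge_space A) <= #|vertices M| + #|A|)%N.
Proof.
move: {2}#|A| (erefl #|A|) => m; elim: m A => [|m IHm] A cardA sA.
  have -> : A = set0 by apply/eqP; rewrite -cards_eq0 cardA.
  rewrite /edge_space big_pred0 ?dimv0 => [|d]; last by rewrite inE.
  rewrite cards0 muln0 leq_add2r /vertices /boundary.
  suff -> : restr_inv (@set0 {set dart M}) = 1%g by rewrite mul1g.
  by apply/permP => d; rewrite restr_invE inE perm1.
have [e eA] : exists e, e \in A by apply/card_gt0P; rewrite cardA.
have /imsetP[d _ de] := subsetP sA _ eA.
have dB : porbit (inv M) d \notin A :\ e by rewrite -de !inE eqxx.
have cardB : #|A :\ e| = m by move: cardA; rewrite (cardsD1 e) eA => -[].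
have := IHm _ cardB (subset_trans (subsetDl _ _) sA).
have := porbits_mul_tperm (boundary (A :\ e)) d (inv M d).
rewrite /= -boundary_add // -de setD1K // [d == _]eq_sym inv_free cardA cardB.
have : (\dim (edge_space A) <=
  \dim (edge_space (A :\ e)) +
    (d \notin porbit (boundary (A :\ e)) (inv M d)))%N.
  rewrite -{1}(setD1K eA) setUC edge_spaceU.
  have sE : (edge_space [set e] <= <[b d - b (inv M d)]>)%VS.
    apply/subv_sumP => x; rewrite inE de eq_porbit_mem edgeE !inE.
    case/pred2P=> ->; first exact: subvv.
    by rewrite inv_invol -memvE -memvN opprB memv_line.
  (* With both ends on one boundary component, the new vector is in the span. *)
  have [dd|_] /= := boolP (d \in _).
    rewrite addn0 dimvS // subv_add subvv (subv_trans sE) //.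
    by rewrite -memvE boundary_edge_space // porbit_sym.
  apply: leq_trans (dimvS (addvS (subvv _) sE)) _.
  apply: leq_trans (leq_of_leqif (dimv_add_leqif _ _)) _.
  by rewrite leq_add2l dim_vline leq_b1.
lia.
Qed.

End EdgeSpace.
End Ribbon.

(** * The rank condition for graphs of minimum degree three *)

Lemma min_degree_le (G : sgraph) (x : G) : (min_degree G <= degree x)%N.
Proof.
rewrite /min_degree; elim: index_enum (mem_index_enum x) => // y s IHs.
rewrite inE big_cons geq_min => /predU1P[->|/IHs ->]; last exact: orbT.
by rewrite leqnn.
Qed.

Section EmbeddedGraph.
Variables (G : sgraph) (r : embedding G).
Let M := ribbon r.
Implicit Types F : {set {set dart M}}.

Definition vertex_vec (x : G) : 'rV[rat]_#|G| := delta_mx 0 (enum_rank x).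

Definition origin_vec (d : dart M) : 'rV[rat]_#|G| := vertex_vec (origin d).

Lemma origin_vec_rot d : origin_vec (rot M d) = origin_vec d.
Proof.
have : rot M d \in porbit (rot M) d by rewrite -{1}(expg1 (rot M)) mem_porbit.
by rewrite /= rotationP inE /origin_vec => /eqP ->.
Qed.

Lemma card_vertices_le : (#|vertices M| <= #|G|)%N.
Proof.
have -> : vertices M =
    (fun x => [set d | origin d == x]) @: [set origin d | d : dart M].
  apply/setP => V; apply/imsetP/imsetP => [[d _ ->]|[_ /imsetP[d _ ->] ->]].
    by exists (origin d); rewrite ?imset_f //= rotationP.
  by exists d; rewrite //= rotationP.
exact: leq_trans (leq_imset_card _ _) (max_card _).
Qed.

Definition edge_rank F : nat := \dim (edge_space origin_vec F).

(** Vertices are equivalent when the difference of their vectors is in the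
span; [choose] depends only on the extension of the predicate, so it selects
the same vertex throughout a class. *)
Definition class_rep F (x : G) : G :=
  choose (fun y => vertex_vec y - vertex_vec x \in edge_space origin_vec F) x.

Lemma class_repP F x :
  vertex_vec (class_rep F x) - vertex_vec x \in edge_space origin_vec F.
Proof.
rewrite /class_rep; set P := fun y => _ - vertex_vec x \in _.
by apply: (@chooseP _ P); rewrite /P subrr mem0v.
Qed.

Lemma class_rep_eq F x y :
  vertex_vec x - vertex_vec y \in edge_space origin_vec F ->
  class_rep F x = class_rep F y.
Proof.
move=> xy; rewrite /class_rep; set P := fun z => _ - vertex_vec x \in _.
set Q := fun z => _ - vertex_vec y \in _.
have PQ : P =1 Q.
  move=> z; apply/idP/idP => zin.
    by rewrite /Q -(subrKA (vertex_vec x)) memvD.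
  by rewrite /P -(subrKA (vertex_vec y)) memvD // -memvN opprB.
by rewrite -(eq_choose PQ); apply: choose_id; last rewrite PQ;
  rewrite ?/P ?/Q subrr mem0v.
Qed.

(** Modulo the span, the vectors of the class representatives generate the
whole space. *)
Lemma card_le_edge_rank F :
  (#|G| <= edge_rank F + #|[set class_rep F x | x : G]|)%N.
Proof.
set R := [set _ | _ in _]; pose W := (\sum_(x in R) <[vertex_vec x]>)%VS.
have dimW : (\dim W <= #|R|)%N.
  apply: leq_trans (dimv_leq_sum _ _ _) _; rewrite -sum1_card leq_sum // => x _.
  by rewrite dim_vline leq_b1.
apply: leq_trans (leq_add (leqnn _) dimW).
apply: leq_trans (leq_of_leqif (dimv_add_leqif _ _)).
suff -> : (edge_space origin_vec F + W)%VS = fullv.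
  by rewrite dimvf dim_matrix mul1r.
apply/eqP; rewrite eqEsubv subvf /=; apply/subvP => w _.
rewrite (row_sum_delta w) memv_suml // => j _; apply: memvZ.
rewrite -(enum_valK j) -/(vertex_vec _); set x := enum_val j.
rewrite -[vertex_vec x](subrK (vertex_vec (class_rep F x))) memv_add //.
  by rewrite -memvN opprB class_repP.
by rewrite memvE (sumv_sup (class_rep F x)) ?imset_f.
Qed.

(** A neighbour of x is reached along an edge of F, and is then another vertex
of the class of x, or along an edge outside F; simplicity keeps the first kind
below the size of the class. *)
Lemma degree_le_class F x : class_rep F x = x ->
  (degree x < #|[set y | class_rep F y == x]| +
     #|[set d : dart M | (porbit (inv M) d \notin F) && (origin d == x)]|)%N.
Proof.
move=> xx; set C := [set y | _]; set D := [set d | _].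
have xC : x \in C by rewrite inE xx.
rewrite (cardsD1 x C) xC add1n addSn ltnS.
apply: leq_trans (leq_add (leqnn _) (leq_imset_card (fun d => (val d).2) _)).
apply: leq_trans (leq_card_setU _ _); apply/subset_leq_card/subsetP => y.
rewrite !inE => xy.
have -> /= : y != x by apply: contraTneq xy => ->; rewrite adj_irr.
pose d : dart M := exist _ (x, y) xy.
have [dF|dF] := boolP (porbit (inv M) d \in F); last first.
  by apply/orP; right; apply/imsetP; exists d; rewrite // inE dF /=.
apply/orP; left; apply/eqP; rewrite -[RHS]xx; apply/esym/class_rep_eq.
by have := mem_edge_space origin_vec dF; rewrite /origin_vec /= permE.
Qed.

(** Each representative x yields four units, from the vertices of its class
and the darts at x outside F; distinct representatives use disjoint sets, and
an edge outside F has two darts. *)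
Lemma card_classes_le F : F \subset edges M -> (3 <= min_degree G)%N ->
  (4 * #|[set class_rep F x | x : G]| <= #|G| + 2 * #|edges M :\: F|)%N.
Proof.
move=> sF deg3; rewrite -card_darts_over ?subsetDl //.
set R := [set _ | _ in _].
have Rrep x : x \in R -> class_rep F x = x.
  by move=> /imsetP[y _ ->]; apply/class_rep_eq/class_repP.
have cardG : #|G| = (\sum_(x in R) #|[set y | class_rep F y == x]|)%N.
  rewrite -cardsT -sum1_card (partition_big (class_rep F) (mem R)) /=.
    apply: eq_bigr => x _; rewrite -sum1_card; apply: eq_bigl => y.
    by rewrite !inE.
  by move=> x _; rewrite imset_f.
have le_R : (\sum_(x in R) #|[set d : dart M |
      (porbit (inv M) d \notin F) && (origin d == x)]| <=
    #|[set d | porbit (inv M) d \in edges M :\: F]|)%N.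
  rewrite -[leqRHS]sum1_card (partition_big (@origin G) predT) //=.
  rewrite [leqRHS](bigID (mem R)) /=; apply: leq_trans (leq_addr _ _).
  apply: leq_sum => x _; rewrite -sum1_card; apply/eq_leq/eq_bigl => d.
  by rewrite !inE imset_f ?andbT.
rewrite [in leqRHS]cardG mulnC -sum_nat_const.
apply: leq_trans (leq_add (leqnn _) le_R); rewrite -big_split /=.
apply: leq_sum => x /Rrep /degree_le_class.
by apply: leq_ltn_trans; apply: leq_trans deg3 (min_degree_le x).
Qed.

End EmbeddedGraph.

(** Euler's formula with the number of components bounded below by one, for the
component of some dart. *)
Lemma genus_ge (M : ribbon_graph) : (0 < #|dart M|)%N ->
  1 - (#|vertices M|%:R - #|edges M|%:R + #|faces M|%:R) / 2%:R <= genus M.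
Proof.
case/card_gt0P => d _; rewrite /genus lerD2r ler1n card_gt0.
by apply/set0Pn; exists (orbit 'P <<[set rot M; inv M]>>%g d); apply: imset_f.
Qed.

Theorem corollary1p7 (G : sgraph) (r : embedding G)
    (Gconn : connected G) (Gplanar : spherical r)
    (Gdeg : (3 <= min_degree G)%N) :
  #|G|%:R / 2%:R + 1 <= max_partial_dual_genus (ribbon r).
Proof.
set M := ribbon r; have rot_b := @origin_vec_rot G r.
have rank_sub : submodular (@edge_rank G r) by apply: edge_rank_submodular.
have [A sA rankA] : exists2 A : {set {set dart M}}, A \subset edges M &
    (* [uphalf] rounds 3n/2 up, as the ranks are integers. *)
    (uphalf (3 * #|G|) <= edge_rank A + edge_rank (edges M :\: A))%N.
  apply: submodular_split => // F sF.
  have := card_le_edge_rank F; have := card_classes_le sF Gdeg.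
  rewrite -/M; lia.
have dart_gt0 : (0 < #|dart M|)%N.
  have [/card_gt0P[x _] _] := Gconn.
  have /card_gt0P[y] := leq_trans (ltnW (ltnW Gdeg)) (min_degree_le x).
  by rewrite inE => xy; apply/card_gt0P; exists (exist _ (x, y) xy).
have genusA : genus (partial_dual A) <= max_partial_dual_genus M.
  exact: Order.TotalTheory.le_bigmax_cond.
apply: le_trans (le_trans (genus_ge (M := partial_dual A) dart_gt0) genusA).
rewrite faces_partial_dual.
have sAc : edges M :\: A \subset edges M by apply: subsetDl.
have := card_boundary_le rot_b sA; have := card_boundary_le rot_b sAc.
have := card_vertices_le r; have := cardsID A (edges M).
rewrite (setIidPr sA) -/M -!/(edge_rank _).
have -> : vertices (partial_dual A) = porbits (boundary A) by [].
have -> : edges (partial_dual A) = edges M by [].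
move=> cardE leV lefc lef.
have : (#|porbits (boundary A)| + #|porbits (boundary (edges M :\: A))|
    + #|G| <= #|edges M|)%N by move: rankA cardE leV lefc lef; lia.
rewrite -(ler_nat rat) !natrD; lra.
Qed.
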